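(* Let $(X,G)$ be a dynamical system whose product $(X^2,G)$ is pointwise uniquely ergodic. Then $(X,G)$ has infinite separation numbers with respect to some Følner sequence if and only if it has infinite separation numbers with respect to all Følner sequences. Moreover, $\overline{\mathrm{ac}}_{\mathcal F}(X,G)$ and $\underline{\mathrm{ac}}_{\mathcal F}(X,G)$ are independent of the particular Følner sequence $\mathcal F$ in $G$.
   Context: A dynamical system $(X,G)$ consists of a compact metric space $(X,d)$, a topological group $G$ and a continuous action $G\times X\to X$, $(g,x)\mapsto gx$, by homeomorphisms. Throughout, $G$ is locally compact, $\sigma$-compact and amenable, with left Haar measure $m=|\cdot|$. A (left) Følner sequence is a sequence $\mathcal F=(F_n)_{n\in\mathbb N}$ of compact subsets of $G$ of positive Haar measure with $\lim_{n\to\infty} m(KF_n\triangle F_n)/m(F_n)=0$ for every compact $K\subseteq G$; ''Følner sequence'' means left Følner sequence. $(X^2,G)$ is the product system with $g(x,y)=(gx,gy)$. A system is pointwise uniquely ergodic if the closure of each orbit supports exactly one $G$-invariant Borel probability measure. For measurable $E\subseteq G$ let $\mathrm{ad}_{\mathcal F}(E)=\limsup_{n\to\infty}|E\cap F_n|/|F_n|$. For $\delta>0$ and $x,y\in X$ let $\Delta(X,G,\delta,x,y)=\{t\in G: d(tx,ty)\ge\delta\}$. For $\nu\in(0,1]$, a set $S\subseteq X$ is $(\delta,\nu)$-separated with respect to $\mathcal F$ if $\mathrm{ad}_{\mathcal F}(\Delta(X,G,\delta,x,y))\ge\nu$ for all distinct $x,y\in S$. $\mathrm{Sep}_{\mathcal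 F}(X,G,\delta,\nu)$ is the supremum of the cardinalities of $(\delta,\nu)$-separated sets. $(X,G)$ has finite separation numbers with respect to $\mathcal F$ if $\mathrm{Sep}_{\mathcal F}(X,G,\delta,\nu)<\infty$ for all $\delta>0$, $\nu\in(0,1]$; otherwise it has infinite separation numbers with respect to $\mathcal F$. Lower and upper amorphic complexity are $$\underline{\mathrm{ac}}_{\mathcal F}(X,G)=\sup_{\delta>0}\liminf_{\nu\to0}\frac{\log\mathrm{Sep}_{\mathcal F}(X,G,\delta,\nu)}{-\log\nu},\qquad \overline{\mathrm{ac}}_{\mathcal F}(X,G)=\sup_{\delta>0}\limsup_{\nu\to0}\frac{\log\mathrm{Sep}_{\mathcal F}(X,G,\delta,\nu)}{-\log\nu},$$ both set to be $\infty$ if $(X,G)$ has infinite separation numbers with respect to $\mathcal F$. *)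

(* Defs.v *)
From HB Require Import structures.
From mathcomp Require Import all_boot all_order all_algebra.
From mathcomp Require Import all_classical all_reals all_analysis.

Set Implicit Arguments.
Unset Strict Implicit.
Unset Printing Implicit Defensive.

Import Order.TTheory GRing.Theory Num.Theory.
Import numFieldNormedType.Exports.

Local Open Scope classical_set_scope.
Local Open Scope ring_scope.

HB.mixin Record isTopologicalGroup G & Topological G & Group G := {
  mulg_continuous : continuous (fun p : G * G => (p.1 * p.2)%g) ;
  invg_continuous : continuous (fun g : G => g^-1%g)
}.

#[short(type="topologicalGroupType")]
HB.structure Definition TopologicalGroup :=
  {G of Topological G & Group G & isTopologicalGroup G}.

(* [measurableType] requires a pointed carrier, whereas the spaces considered
   here need not be pointed, nor even nonempty. The alias [based x] of [T] is
   pointed by x; the choice of x has no influence on the Borel sets. *)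
Definition based (T : Type) (x : T) : Type := T.

HB.instance Definition _ (T : topologicalType) (x : T) :=
  Topological.on (based x).
HB.instance Definition _ (T : topologicalType) (x : T) :=
  isPointed.Build (based x) x.

Notation borel x := (g_sigma_algebraType (@open (based x))).

Definition sigma_compact (T : topologicalType) (A : set T) :=
  exists2 K : nat -> set T, (forall n, compact (K n)) & A = \bigcup_n K n.

Section group.
Context {R : realType} {G : topologicalGroupType}.
Local Open Scope ereal_scope.

Definition left_haar (m : {measure set (borel (1%g : G)) -> \bar R}) :=
  [/\ m setT != 0,
      (forall K : set G, compact K -> m K < +oo),
      (forall (g : G) (A : set (borel (1%g : G))), measurable A ->
         m [set (g * a)%g | a in A] = m A),
      (forall A : set (borel (1%g : G)), measurable A ->
         m A = ereal_inf [set m U | U in [set U : set G | open U /\ A `<=` U]])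
    & (forall U : set G, open U ->
         m U =
         ereal_sup [set m K | K in [set K : set G | compact K /\ K `<=` U]])].

Definition mulset (A B : set G) : set G :=
  [set (a * b)%g | a in A & b in B].

(* Følner's condition. The condition K !=set0, here and in [folner], is
   implicit in the literature: m (set0 F `+` F) = m F. *)
Definition amenable (m : {measure set (borel (1%g : G)) -> \bar R}) :=
  forall (K : set G) (e : R), compact K -> K !=set0 -> (0 < e)%R ->
  exists2 F : set G, compact F & m (mulset K F `+` F) < e%:E * m F.

Definition folner (m : {measure set (borel (1%g : G)) -> \bar R})
    (F : nat -> set G) :=
  [/\ forall n, compact (F n),
      forall n, 0 < m (F n)
    & forall K : set G, compact K -> K !=set0 ->
        m (mulset K (F n) `+` F n) / m (F n) @[n --> \oo] --> 0].

Definition upper_density (m : {measure set (borel (1%g : G)) -> \bar R})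
    (F : nat -> set G) (E : set G) : \bar R :=
  limn_esup (fun n => m (E `&` F n) / m (F n)).

End group.

Section action.
Context {G : topologicalGroupType} {T : topologicalType}.

Definition continuous_action (act : G -> T -> T) :=
  [/\ continuous (fun p : G * T => act p.1 p.2),
      forall x, act 1%g x = x
    & forall g h x, act (g * h)%g x = act g (act h x)].

Definition orbit (act : G -> T -> T) (x : T) : set T := range (act^~ x).

Definition product_action (act : G -> T -> T) (g : G) (p : T * T) : T * T :=
  (act g p.1, act g p.2).

Definition invariant_measure (R : realType) (act : G -> T -> T) (x : T)
    (mu : probability (borel x) R) :=
  forall (g : G) (A : set (borel x)), measurable A ->
    mu (act g @^-1` A) = mu A.

(* Measures supported by the orbit closure are measures on T giving it full
   mass. They are compared on Borel sets only, since a measure of the library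
   is a total function, unconstrained on nonmeasurable sets. *)
Definition pointwise_uniquely_ergodic (R : realType) (act : G -> T -> T) :=
  forall x : T,
  let invariant_on (mu : probability (borel x) R) :=
    invariant_measure act mu /\ mu (closure (orbit act x)) = 1%E in
  exists2 mu, invariant_on mu &
  forall nu, invariant_on nu ->
    forall A : set (borel x), measurable A -> nu A = mu A.

End action.

Section amorphic_complexity.
Context {R : realType} {G : topologicalGroupType} {X : metricType R}.
Variables (m : {measure set (borel (1%g : G)) -> \bar R}) (act : G -> X -> X).
Variable F : nat -> set G.

Definition separation_times (delta : R) (x y : X) : set G :=
  [set t | delta <= mdist (act t x) (act t y)].

Definition separated (delta nu : R) (S : set X) :=
  forall x y, S x -> S y -> x <> y ->
    (nu%:E <= upper_density m F (separation_times delta x y))%E.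

Definition Sep (delta nu : R) : \bar R :=
  ereal_sup [set counting S | S in separated delta nu].

Definition finite_separation_numbers :=
  forall delta nu : R, 0 < delta -> 0 < nu <= 1 -> (Sep delta nu < +oo)%E.

Definition infinite_separation_numbers := ~ finite_separation_numbers.

Definition ac_quotient (delta nu : R) : \bar R :=
  (lne (Sep delta nu) / (- ln nu)%:E)%E.

Definition lower_ac : \bar R :=
  if `[< infinite_separation_numbers >] then +oo%E else
  ereal_sup [set limf_einf (ac_quotient delta) 0^'+
            | delta in [set delta | 0 < delta]].

Definition upper_ac : \bar R :=
  if `[< infinite_separation_numbers >] then +oo%E else
  ereal_sup [set limf_esup (ac_quotient delta) 0^'+
            | delta in [set delta | 0 < delta]].

End amorphic_complexity.

(* Main.v *)
(* Fix a pair p = (x, y). Along an ultrafilter W on the indices, the visit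
   frequencies m({t in F_n | t p in A}) / m(F_n) converge for every closed A, and
   the limit is a content on the closed subsets of X^2 which is invariant, by the
   Folner condition, and gives mass 1 to the orbit closure of p. As in Halmos'
   construction, a content on the closed subsets of a compact Hausdorff space
   induces a Borel measure, equal to sup {content K | K closed, K <= U} on an
   open U; by unique ergodicity this supremum depends neither on F nor on W.
   Sandwiching {d >= delta} <= {d > delta'} <= {d >= delta'} for delta' < delta
   then gives ad_F(Delta(delta, x, y)) <= ad_F'(Delta(delta', x, y)) for any two
   Folner sequences F and F', hence Sep_F(delta, nu) <= Sep_F'(delta', nu), and
   both claims follow since delta ranges over all positive reals. The implication
   from "all" to "some" moreover needs a Folner sequence, which amenability
   provides along a compact exhaustion of G. *)

Require Import Defs.
From HB Require Import structures.
From mathcomp Require Import all_boot all_order all_algebra.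
From mathcomp Require Import all_classical all_reals all_analysis.
From mathcomp Require Import lra.

Set Implicit Arguments.
Unset Strict Implicit.
Unset Printing Implicit Defensive.

Import Order.TTheory GRing.Theory Num.Theory.
Import numFieldNormedType.Exports.

Local Open Scope classical_set_scope.
Local Open Scope ring_scope.

(** * Borel measures from contents on closed sets *)

Section closed_content.
Context {R : realType} {T : topologicalType}.
Local Open Scope ereal_scope.
Implicit Types (lam : set T -> \bar R) (K L U V : set T).

(** Halmos' notion of content, with closed sets in place of compact ones and normalised. Values off
    the closed sets are unconstrained. Additivity on disjoint sets is split into two inequalities,
    because subadditivity is also used for overlapping sets. *)
Definition closed_content lam :=
  [/\ lam setT = 1,
      forall K, closed K -> 0 <= lam K,
      forall K L, closed K -> closed L -> K `<=` L -> lam K <= lam L,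
      forall K L, closed K -> closed L -> lam (K `|` L) <= lam K + lam L
    & forall K L, closed K -> closed L -> K `&` L = set0 ->
        lam K + lam L <= lam (K `|` L)].

Definition inner_content lam U : \bar R :=
  ereal_sup [set lam K | K in [set K | closed K /\ K `<=` U]].

Definition outer_content lam (A : set T) : \bar R :=
  ereal_inf [set inner_content lam U | U in [set U | open U /\ A `<=` U]].

Lemma inner_content_ub lam K U :
  closed K -> K `<=` U -> lam K <= inner_content lam U.
Proof. by move=> cK KU; apply: ereal_sup_ubound; exists K. Qed.

Lemma le_inner_content lam U V :
  U `<=` V -> inner_content lam U <= inner_content lam V.
Proof.
move=> UV; apply: ge_ereal_sup => _ [K [cK KU] <-].
by apply: inner_content_ub => //; exact: subset_trans UV.
Qed.

Lemma outer_content_lb lam A U :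
  open U -> A `<=` U -> outer_content lam A <= inner_content lam U.
Proof. by move=> oU AU; apply: ereal_inf_lbound; exists U. Qed.

Lemma le_outer_content lam A B :
  A `<=` B -> outer_content lam A <= outer_content lam B.
Proof.
move=> AB; apply: le_ereal_inf_tmp => _ [U [oU BU] <-].
by apply: outer_content_lb => //; exact: subset_trans BU.
Qed.

Lemma outer_content_open lam U :
  open U -> outer_content lam U = inner_content lam U.
Proof.
move=> oU; apply/eqP; rewrite eq_le outer_content_lb//=.
by apply: le_ereal_inf_tmp => _ [V [oV UV] <-]; exact: le_inner_content.
Qed.

Section theory.
Variable lam : set T -> \bar R.
Hypothesis lamC : closed_content lam.

(** The disjoint pair [set0], [set0] gives c + c <= c for c = [lam set0], and c is finite since 0 <=
    c <= 1. *)
Lemma content_set0 : lam set0 = 0.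
Proof.
have [lam1 lam_ge0 le_lam _ lamD] := lamC.
have c0 : closed (set0 : set T) by exact: closed0.
have := le_lam _ _ c0 closedT (@sub0set _ _); rewrite lam1.
have := lamD _ _ c0 c0 (setI0 _); rewrite setU0.
have := lam_ge0 _ c0; case: (lam set0) => // r.
rewrite -EFinD !lee_fin => r0 rr _.
by congr EFin; apply/eqP; rewrite eq_le r0 andbT -(lerD2l r) addr0.
Qed.

Lemma inner_content_ge0 U : 0 <= inner_content lam U.
Proof. by rewrite -content_set0; apply: inner_content_ub => //; exact: closed0. Qed.

Lemma inner_content_le1 U : inner_content lam U <= 1.
Proof.
have [<- _ le_lam _ _] := lamC; apply: ge_ereal_sup => _ [K [cK _] <-].
by apply: le_lam => //; exact: closedT.
Qed.

Lemma inner_content_fin U : inner_content lam U \is a fin_num.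
Proof.
rewrite ge0_fin_numE ?inner_content_ge0//.
by rewrite (le_lt_trans (inner_content_le1 _))// ltry.
Qed.

Lemma inner_contentT : inner_content lam setT = 1.
Proof.
apply/eqP; rewrite eq_le inner_content_le1/=.
by have [<- _ _ _ _] := lamC; apply: inner_content_ub => //; exact: closedT.
Qed.

Lemma outer_content_ge0 A : 0 <= outer_content lam A.
Proof. by apply: le_ereal_inf_tmp => _ [U _ <-]; exact: inner_content_ge0. Qed.

Lemma outer_content_fin A : outer_content lam A \is a fin_num.
Proof.
rewrite ge0_fin_numE ?outer_content_ge0// (@le_lt_trans _ _ 1) ?ltry//.
by rewrite -inner_contentT; apply: outer_content_lb => //; exact: openT.
Qed.

Lemma outer_content0 : outer_content lam set0 = 0.
Proof.
apply/eqP; rewrite eq_le outer_content_ge0 andbT outer_content_open//; last first.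
  exact: open0.
by apply: ge_ereal_sup => _ [K [_ K0] <-]; rewrite (_ : K = set0) ?content_set0 -?subset0.
Qed.

Lemma outer_content_full K : closed K -> lam K = 1 -> outer_content lam K = 1.
Proof.
move=> cK lamK; apply/eqP; rewrite eq_le; apply/andP; split.
  rewrite -inner_contentT -outer_content_open; last exact: openT.
  exact: le_outer_content.
apply: le_ereal_inf_tmp => _ [U [oU KU] <-].
by rewrite -lamK; exact: inner_content_ub.
Qed.

(* [K] and [L] range over closed subsets of [U `&` V] and [V `\` K]. *)
Lemma inner_content_split U V : open U -> open V ->
  inner_content lam (V `&` U) + outer_content lam (V `&` ~` U)
    <= inner_content lam V.
Proof.
have [_ lam_ge0 _ _ lamD] := lamC; move=> oU oV.
rewrite -leeBrDr ?outer_content_fin//.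
apply: ge_ereal_sup => _ [K [cK KVU] <-].
have lamK : lam K \is a fin_num.
  rewrite ge0_fin_numE ?lam_ge0//; apply: le_lt_trans (ltry 1).
  exact: le_trans (inner_content_ub lam cK KVU) (inner_content_le1 _).
rewrite leeBrDr ?outer_content_fin// addeC -leeBrDr//.
apply: (@le_trans _ _ (inner_content lam (V `&` ~` K))).
  apply: outer_content_lb; first by apply: openI => //; exact: closed_openC.
  by apply: setIS; apply: subsetC => x /KVU[].
apply: ge_ereal_sup => _ [L [cL LVK] <-]; rewrite leeBrDr//.
apply: le_trans (inner_content_ub lam (closedU cL cK) _); last first.
  by move=> x [/LVK[]|/KVU[]].
apply: lamD => //; rewrite -subset0 => x [/LVK[_ nKx] Kx]; exact: nKx.
Qed.

Hypothesis hausdorffT : hausdorff_space T.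
Hypothesis compactT : compact [set: T].

(** A closed [K] inside [U] [|] [V] is cut into two closed pieces, one in each open set. Normality
    provides an open [W] containing [K] minus [V] whose closure lies in [U]; the pieces are [K]
    within [closure W] and [K] minus [W]. *)
Lemma inner_contentU2 U V : open U -> open V ->
  inner_content lam (U `|` V) <= inner_content lam U + inner_content lam V.
Proof.
move=> oU oV; apply: ge_ereal_sup => _ [K [cK KUV] <-].
have cKV : closed (K `&` ~` V) by apply: closedI => //; exact: open_closedC.
have /(compact_normal hausdorffT compactT cKV)[W'] : set_nbhs (K `&` ~` V) U.
  by apply/set_nbhsP; exists U; split => // x [/KUV[]].
move=> /set_nbhsP[W [oW KVW WW']] W'U.
have [_ _ le_lam lamU _] := lamC.
have cKW : closed (K `&` closure W) by apply: closedI => //; exact: closed_closure.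
have cKnW : closed (K `&` ~` W) by apply: closedI => //; exact: open_closedC.
apply: (@le_trans _ _ (lam (K `&` closure W) + lam (K `&` ~` W))).
  apply: le_trans (lamU _ _ cKW cKnW).
  apply: le_lam => // [|x Kx]; first exact: closedU.
  have [Wx|nWx] := pselect (W x); last by right.
  by left; split => //; exact: subset_closure.
apply: leeD; apply: inner_content_ub => //.
  by move=> x [_ /(closureS WW')/W'U].
move=> x [Kx nWx]; apply: contrapT => nVx; apply: nWx.
by apply: KVW; split.
Qed.

Lemma inner_content_bigsetU (U : nat -> set T) n : (forall i, open (U i)) ->
  inner_content lam (\big[setU/set0]_(i < n) U i)
    <= \sum_(i < n) inner_content lam (U i).
Proof.
move=> oU; elim: n => [|n ih].
  by rewrite !big_ord0 -outer_content_open ?outer_content0//; exact: open0.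
rewrite !big_ord_recr/=; apply: le_trans (leeD2r _ ih).
apply: inner_contentU2 => //.
by elim/big_ind : _ => // [|A B]; [exact: open0|exact: openU].
Qed.

Lemma compact_bigcup_sub K (U : nat -> set T) : compact K ->
  (forall i, open (U i)) -> K `<=` \bigcup_i U i ->
  exists n, K `<=` \big[setU/set0]_(i < n) U i.
Proof.
move=> /compact_near_coveringP cK oU KU.
(* Near-covering form of compactness: each point lies, together with a neighbourhood, in all partial
   unions of large index, so a single index serves all of [K]. *)
have [|N _ /(_ _ (leqnn N)) KN] :=
    cK nat \oo (fun n x => (\big[setU/set0]_(i < n) U i) x) _.
  move=> x /KU[k _ Ukx]; exists (U k, [set n | (k < n)%N]) => /=.
    split; first by apply: open_nbhs_nbhs; split.
    by exists k.+1.
  by move=> [y n]/= [Uky kn]; rewrite -bigcup_mkord; exists k.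
by exists N.
Qed.

(** Every closed [K] competing in the supremum is compact, so finitely many [U i] cover it and
    finite subadditivity applies. *)
Lemma inner_content_bigcup (U : nat -> set T) : (forall i, open (U i)) ->
  inner_content lam (\bigcup_i U i) <= \sum_(i <oo) inner_content lam (U i).
Proof.
move=> oU; apply: ge_ereal_sup => _ [K [cK KU] <-].
have [n Kn] := compact_bigcup_sub (subclosed_compact cK compactT (@subsetT _ _))
  oU KU.
apply: le_trans (inner_content_ub lam cK Kn) _.
apply: le_trans (inner_content_bigsetU n oU) _.
rewrite -(big_mkord xpredT (fun i => inner_content lam (U i))).
by apply: nneseries_lim_ge => i _ _; exact: inner_content_ge0.
Qed.

Lemma outer_content_sigma_subadditive : sigma_subadditive (outer_content lam).
Proof.
move=> A; apply/lee_addgt0Pr => e e0.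
apply: le_trans (epsilon_trick _ _ (ltW e0)); last first.
  by move=> n; exact: outer_content_ge0.
have [U PU] : {U : nat -> set T & forall n, [/\ open (U n), A n `<=` U n &
    inner_content lam (U n) <= outer_content lam (A n) + (e / (2 ^ n.+1)%:R)%:E]}.
  apply: (@choice _ _ (fun n V => [/\ open V, A n `<=` V &
    inner_content lam V <= outer_content lam (A n) + (e / (2 ^ n.+1)%:R)%:E])).
  move=> n; have en : (0 < e / (2 ^ n.+1)%:R)%R.
    by rewrite divr_gt0// ltr0n expn_gt0.
  have [_ [V [oV AV] <-] /ltW] := lb_ereal_inf_adherent en (outer_content_fin (A n)).
  by exists V.
have oU i : open (U i) by have [] := PU i.
apply: (@le_trans _ _ (inner_content lam (\bigcup_i U i))).
  apply: outer_content_lb; first by apply: bigcup_open => i _.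
  by apply: subset_bigcup => i _; have [] := PU i.
apply: le_trans (inner_content_bigcup oU) _.
apply: lee_nneseries => i; first by move=> _ _; exact: inner_content_ge0.
by move=> _; have [] := PU i.
Qed.

(** Caratheodory's construction: [inner_content_split] makes open sets Caratheodory measurable,
    hence all Borel sets, and the outer measure is sigma-additive on them. *)
Lemma outer_content_measure (x : T) : exists mu : probability (borel x) R,
  forall A : set (borel x), measurable A -> mu A = outer_content lam A.
Proof.
pose om : {outer_measure set (based x) -> \bar R} := HB.pack (outer_content lam)
  (isOuterMeasure.Build R (based x) (outer_content lam) outer_content0
     outer_content_ge0 (@le_outer_content lam) outer_content_sigma_subadditive).
have oM (U : set (based x)) : open U -> om.-caratheodory U.
  move=> oU; apply: le_caratheodory_measurable => A.
  (* The test set [A] may be replaced by an open [V] containing it, since the outer content of [A]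
     is an infimum over such [V]. *)
  apply: le_ereal_inf_tmp => _ [V [oV AV] <-].
  apply: le_trans (inner_content_split oU oV).
  rewrite -[inner_content _ (V `&` U)]outer_content_open; last exact: openI.
  by apply: leeD; apply: le_outer_content; exact: setSI.
have bM (A : set (borel x)) : measurable A -> om.-cara.-measurable A.
  apply: smallest_sub; last by move=> U; exact: oM.
  split => [|B|B]; first exact: measurable0.
    by rewrite setTD; exact: measurableC.
  by move=> mB; apply: bigcup_measurable => k _; exact: mB.
have om_sigma : semi_sigma_additive (outer_content lam : set (borel x) -> \bar R).
  move=> A mA tA mUA.
  exact: (@caratheodory_measure_sigma_additive _ _ om A (fun i => bM _ (mA i)) tA
    (bM _ mUA)).
pose isM := isMeasure.Build _ (borel x) R (outer_content lam) outer_content0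
  outer_content_ge0 om_sigma.
pose mu0 : {measure set (borel x) -> \bar R} :=
  HB.pack (outer_content lam : set (borel x) -> \bar R) isM.
have mu0T : mu0 setT = 1.
  by rewrite -inner_contentT -outer_content_open//; exact: openT.
pose mu : probability (borel x) R :=
  HB.pack (outer_content lam : set (borel x) -> \bar R) isM
    (Measure_isProbability.Build _ _ _ mu0 mu0T).
by exists mu.
Qed.

End theory.
End closed_content.

(** * Limits along ultrafilters *)

Section ultralimit.
Context {R : realType} (W : set_system nat) {ultraW : UltraFilter W}.
Implicit Types u v w : nat -> R.

#[local] Instance properW : ProperFilter W := ultra_proper.

(** Compactness of [0, 1] gives a cluster point. An ultrafilter converges to its cluster points: if
    the preimage of a neighbourhood were not in [W], its complement would be, contradicting
    clustering. *)
Lemma ultralimit_cvg u : (forall n, 0 <= u n <= 1) ->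
  u n @[n --> W] --> lim (u n @[n --> W]).
Proof.
move=> u01; have [] := @segment_compact R 0 1 (u n @[n --> W]) _ _.
  by apply: nearW => n; rewrite /= in_itv/= u01.
move=> l [_ lW]; suff ul : u n @[n --> W] --> l by rewrite (cvg_lim _ ul).
move=> V Vl; have [//|WV] := in_ultra_setVsetC (u @^-1` V) ultraW.
by have [y []] := lW (~` V) V WV Vl.
Qed.

Hypothesis tailW : \oo `<=` W.

Lemma ultralimit_le_limn_esup u : (forall n, 0 <= u n <= 1) ->
  ((lim (u n @[n --> W]))%:E <= limn_esup (EFin \o u))%E.
Proof.
move=> u01; apply: le_ereal_inf_tmp => _ [V /tailW WV <-].
apply: (@cvge_to_le _ W _ _ (EFin \o u)).
  by apply: cvg_EFin; [exact: nearW|exact: ultralimit_cvg].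
by apply: filterS WV => n Vn; apply: ereal_sup_ubound; exists n.
Qed.

(** Turns an asymptotic estimate, such as the Folner condition, into an exact equality of limits
    along [W]. *)
Lemma eq_ultralimit u v w :
  (forall n, 0 <= u n <= 1) -> (forall n, 0 <= v n <= 1) ->
  (forall n, `|u n - v n| <= w n) -> w n @[n --> \oo] --> 0 ->
  lim (u n @[n --> W]) = lim (v n @[n --> W]).
Proof.
move=> u01 v01 uvw w0; apply/eqP; rewrite -subr_eq0; apply/eqP.
have uv := [elaborate cvgB (ultralimit_cvg u01) (ultralimit_cvg v01)].
rewrite -(cvg_lim (@Rhausdorff R) uv); apply: (cvg_lim (@Rhausdorff R)).
apply/norm_cvg0P; apply: (@squeeze_cvgr _ _ _ _ (cst 0) w).
- by apply: nearW => n; rewrite /= normr_ge0 uvw.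
- exact: cvg_cst.
- by apply: cvg_trans w0 => A; exact: tailW.
Qed.

End ultralimit.

(* For [e > 0], the set of all [n] with [limsup u <= u n + e] meets every tail. *)
Lemma limn_esup_le_ultralimit {R : realType} (u : nat -> R) (e : R) :
  (forall n, 0 <= u n <= 1) -> 0 < e ->
  exists W : set_system nat, [/\ UltraFilter W, \oo `<=` W &
    (limn_esup (EFin \o u) <= (lim (u n @[n --> W]))%:E + e%:E)%E].
Proof.
move=> u01 e0; set L := limn_esup _.
pose B := [set n | (L <= (u n)%:E + e%:E)%E].
have L0 : (0 <= L)%E.
  apply: limf_esup_ge0; first by case=> N _ /(_ N (leqnn N)).
  by move=> n; rewrite lee_fin; case/andP: (u01 n).
have esup1 (V : set nat) : (ereal_sup ((EFin \o u) @` V) <= 1)%E.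
  by apply: ge_ereal_sup => _ [n _ <-]; rewrite lee_fin; case/andP: (u01 n).
have LV V : \oo V -> (L <= ereal_sup ((EFin \o u) @` V))%E.
  by move=> ooV; apply: ereal_inf_lbound; exists V.
have Lfin : L \is a fin_num.
  rewrite ge0_fin_numE// (@le_lt_trans _ _ 1%E) ?ltry//.
  by apply: le_trans (LV setT filterT) (esup1 _).
have properB : ProperFilter (within B \oo).
  split; last exact: within_filter.
  move=> ooB; have := LV _ ooB; apply/negP; rewrite -ltNge.
  apply: (@le_lt_trans _ _ (L - e%:E)%E); last by rewrite lteBlDr// lteDl// lte_fin.
  apply: ge_ereal_sup => _ [n nB <-]; rewrite leeBrDr//.
  by rewrite leNgt; apply/negP => /ltW /nB.
(* The ultrafilter refines the trace of the tails on [B]; as [B] belongs to it, the limit of [u] is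
   at least [L] minus [e]. *)
have [W [ultraW BW]] := ultraFilterLemma properB.
have tailW : \oo `<=` W by move=> V ooV; apply: BW; apply: filterS ooV.
have WB : W B by apply: BW; apply: nearW.
exists W; split => //; rewrite -leeBlDr//.
apply: (@cvge_to_ge _ W ultra_proper _ (EFin \o u)).
  by apply: cvg_EFin; [exact: nearW|exact: ultralimit_cvg].
by apply: filterS WB => n Bn; rewrite leeBlDr.
Qed.

(** * Visit frequencies in compact subsets of the group *)

Lemma closed_borel (T : topologicalType) (x : T) (A : set T) :
  closed A -> measurable (A : set (borel x)).
Proof.
move=> cA; rewrite -(setCK A); apply: measurableC.
by apply: sub_sigma_algebra; exact: closed_openC.
Qed.

Section topological_group.
Context {G : topologicalGroupType}.
Implicit Types (g : G) (A B K : set G).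

Lemma mulset_compact A B : compact A -> compact B -> compact (mulset A B).
Proof.
move=> cA cB.
have -> : mulset A B = (fun p : G * G => (p.1 * p.2)%g) @` (A `*` B).
  rewrite eqEsubset; split => [_ [a Aa [b Bb <-]]|_ [[a b] [Aa Bb] <-]].
    by exists (a, b).
  by exists a => //; exists b.
apply: continuous_compact; last exact: compact_setX.
by apply: continuous_subspaceT; exact: mulg_continuous.
Qed.

Lemma mulset1g g A : mulset [set g] A = [set (g * a)%g | a in A].
Proof.
rewrite eqEsubset; split => [_ [_ -> [a Aa <-]]|_ [a Aa <-]]; first by exists a.
by exists g => //; exists a.
Qed.

Lemma mulg_continuousl g : continuous (fun t => (g * t)%g : G).
Proof.
move=> t; apply: (@continuous_comp _ _ _ (fun t => (g, t))
  (fun p : G * G => (p.1 * p.2)%g)); last exact: mulg_continuous.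
by apply: cvg_pair => //=; exact: cvg_cst.
Qed.

End topological_group.

Section frequency.
Context {R : realType} {G : topologicalGroupType}.
Variable m : {measure set (borel (1%g : G)) -> \bar R}.
Hypothesis hausdorffG : hausdorff_space G.
Hypothesis haar_m : left_haar m.
Local Notation measurableG A := (measurable (A : set (borel (1%g : G)))).

Lemma compact_borel (K : set G) : compact K -> measurableG K.
Proof. by move=> cK; apply: closed_borel; exact: compact_closed. Qed.

Lemma haar_compact_fin (K : set G) : compact K -> m K \is a fin_num.
Proof.
have [_ mfin _ _ _] := haar_m; move=> cK.
by rewrite ge0_fin_numE ?measure_ge0// mfin.
Qed.

Lemma haar_compact_finI (E K : set G) :
  compact K -> measurableG E -> m (E `&` K) \is a fin_num.
Proof.
move=> cK mE; have [_ mfin _ _ _] := haar_m.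
rewrite ge0_fin_numE ?measure_ge0//; apply: le_lt_trans (mfin _ cK).
by apply: measureIr => //; exact: compact_borel.
Qed.

(** Real-valued, so that the limits along ultrafilters are taken in the reals; [frequencyE] returns
    to the extended quotient. *)
Definition frequency (K E : set G) : R := fine (m (E `&` K)) / fine (m K).

Section theory.
Variable K : set G.
Hypothesis compactK : compact K.
Hypothesis mK_gt0 : (0 < m K)%E.

Let mK : measurableG K. Proof. exact: compact_borel. Qed.

Let fmK_gt0 : 0 < fine (m K).
Proof. by rewrite fine_gt0// mK_gt0 ltey_eq haar_compact_fin. Qed.

Lemma frequencyE E : measurableG E -> (m (E `&` K) / m K)%E = (frequency K E)%:E.
Proof.
move=> mE; rewrite -{1}(fineK (haar_compact_finI compactK mE)).
by rewrite -{1}(fineK (haar_compact_fin compactK)) inver gt_eqF.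
Qed.

Lemma le_frequency E E' : measurableG E -> measurableG E' -> E `<=` E' ->
  frequency K E <= frequency K E'.
Proof.
move=> mE mE' EE'; rewrite ler_pM2r ?invr_gt0//.
apply: fine_le; rewrite ?haar_compact_finI//.
by apply: le_measure; rewrite ?inE//; [exact: measurableI..|exact: setSI].
Qed.

Lemma frequencyT : frequency K setT = 1.
Proof. by rewrite /frequency setTI divff// gt_eqF. Qed.

Lemma frequency_ge0 E : 0 <= frequency K E.
Proof. by rewrite divr_ge0// ?fine_ge0// ltW. Qed.

Lemma frequency01 E : measurableG E -> 0 <= frequency K E <= 1.
Proof. by move=> mE; rewrite frequency_ge0 -frequencyT le_frequency. Qed.

Lemma frequencyU E E' : measurableG E -> measurableG E' ->
  frequency K (E `|` E') <= frequency K E + frequency K E'.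
Proof.
move=> mE mE'; rewrite -mulrDl ler_pM2r ?invr_gt0//.
rewrite -fineD ?haar_compact_finI//; apply: fine_le.
- by rewrite haar_compact_finI//; exact: measurableU.
- by rewrite fin_numD !haar_compact_finI.
by rewrite setIUl; apply: measureU2; exact: measurableI.
Qed.

Lemma frequency_disjointU E E' : measurableG E -> measurableG E' ->
  E `&` E' = set0 -> frequency K (E `|` E') = frequency K E + frequency K E'.
Proof.
move=> mE mE' EE'; rewrite /frequency setIUl measureU ?fineD ?mulrDl//.
- exact: haar_compact_finI.
- exact: haar_compact_finI.
- exact: measurableI.
- exact: measurableI.
- by rewrite setIACA EE' set0I.
Qed.

(** By left invariance, the times t in [K] with g t in [E] have the same measure as [E] within g[K].
    Replacing g[K] by [K] costs at most the measure of their symmetric difference. *)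
Lemma frequency_translate (g : G) (E : set G) : closed E ->
  `|frequency K [set t | E (g * t)%g] - frequency K E|
    <= fine (m (mulset [set g] K `+` K) / m K).
Proof.
move=> cE; have [_ _ minv _ _] := haar_m; set D := mulset _ _ `+` _.
have mE : measurableG E by exact: closed_borel.
have cgE : closed [set t | E (g * t)%g].
  by apply: preimage_closed cE => t _; exact: mulg_continuousl.
have mgE : measurableG [set t | E (g * t)%g] by exact: closed_borel.
have cgK : compact (mulset [set g] K).
  by apply: mulset_compact => //; exact: compact_set1.
have mgK : measurableG (mulset [set g] K) by exact: compact_borel.
have mD : measurableG D by apply: measurableU; exact: measurableD.
have mDfin : m D \is a fin_num.
  rewrite ge0_fin_numE ?measure_ge0//.
  apply: le_lt_trans (_ : _ <= m (mulset [set g] K) + m K)%E _.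
    apply: le_trans (measureU2 _ mgK mK).
    apply: le_measure; rewrite ?inE//; first exact: measurableU.
    by move=> t [[]|[]]; [left|right].
  by rewrite ltey_eq fin_numD !haar_compact_fin.
have -> : frequency K [set t | E (g * t)%g] =
    fine (m (E `&` mulset [set g] K)) / fine (m K).
  congr (fine _ / _); rewrite -[LHS](minv g); last exact: measurableI.
  congr (m _); rewrite mulset1g eqEsubset; split => t.
    by move=> [a [/= Ea Ka] <-]; split => //; exists a.
  by move=> [Et [a Ka ga]]; exists a => //; split => //=; rewrite ga.
(* [E] within [A] is covered by [E] within [B] together with [D]. Exchanging [A] and [B] gives the
   two signs of the absolute value. *)
have le_symdiff A B : measurableG A -> measurableG B ->
    m (E `&` A) \is a fin_num -> m (E `&` B) \is a fin_num -> A `+` B = D ->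
    fine (m (E `&` A)) - fine (m (E `&` B)) <= fine (m D).
  move=> mA mB fA fB AB; rewrite lerBlDl -fineD// fine_le ?fin_numD ?fB//.
  apply: le_trans (measureU2 _ (measurableI _ _ mE mB) mD).
  apply: le_measure; rewrite ?inE//; first exact: measurableI.
    by apply: measurableU => //; exact: measurableI.
  rewrite -AB => t [Et At]; have [Bt|nBt] := pselect (B t); first by left.
  by right; left.
have fgK : m (E `&` mulset [set g] K) \is a fin_num by exact: haar_compact_finI.
have fK : m (E `&` K) \is a fin_num by exact: haar_compact_finI.
rewrite -mulrBl normrM normfV (gtr0_norm fmK_gt0).
rewrite -[m D]fineK// -[X in (_ / X)%E](fineK (haar_compact_fin compactK)).
rewrite inver gt_eqF//= ler_pM2r ?invr_gt0// ler_norml lerNl opprB.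
by rewrite !le_symdiff// /D setYC.
Qed.

End theory.
End frequency.

(** * Invariant contents and unique ergodicity *)

Section invariant_content.
Context {R : realType} {G : topologicalGroupType} {T : topologicalType}.
Variable act : G -> T -> T.
Hypothesis actP : continuous_action act.

Lemma act_continuous g : continuous (act g).
Proof.
have [cact _ _] := actP; move=> x.
apply: (@continuous_comp _ _ _ (fun x => (g, x))
  (fun p : G * T => act p.1 p.2)); last exact: cact.
by apply: cvg_pair => //=; exact: cvg_cst.
Qed.

Lemma orbit_map_continuous x : continuous (act^~ x).
Proof.
have [cact _ _] := actP; move=> g.
apply: (@continuous_comp _ _ _ (fun g => (g, x))
  (fun p : G * T => act p.1 p.2)); last exact: cact.
by apply: cvg_pair => //=; exact: cvg_cst.
Qed.

Lemma actKV g : cancel (act g^-1%g) (act g).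
Proof. by have [_ act1 actM] := actP; move=> x; rewrite -actM mulgV act1. Qed.

Lemma actK g : cancel (act g) (act g^-1%g).
Proof. by have [_ act1 actM] := actP; move=> x; rewrite -actM mulVg act1. Qed.

Section invariance.
Variable lam : set T -> \bar R.
Hypothesis lam_inv : forall g K, closed K -> lam (act g @^-1` K) = lam K.

(** Preimages under any [h] do not increase the inner content, hence not the outer one; the
    inequality for the inverse of [g] gives the converse. *)
Lemma outer_content_invariant g A :
  outer_content lam (act g @^-1` A) = outer_content lam A.
Proof.
have le_inner h U : (inner_content lam (act h @^-1` U) <= inner_content lam U)%E.
  apply: ge_ereal_sup => _ [K [cK KU] <-]; rewrite -(lam_inv h^-1%g cK).
  apply: inner_content_ub.
    by apply: preimage_closed cK => x _; exact: act_continuous.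
  by move=> x /KU; rewrite /= actKV.
have le_outer h B : (outer_content lam (act h @^-1` B) <= outer_content lam B)%E.
  apply: le_ereal_inf_tmp => _ [U [oU BU] <-]; apply: le_trans (le_inner h U).
  apply: outer_content_lb; last by move=> x /BU.
  by apply: open_comp oU => x _; exact: act_continuous.
apply/eqP; rewrite eq_le le_outer/=.
have {1}-> : A = act g^-1%g @^-1` (act g @^-1` A).
  by apply/seteqP; split => x /=; rewrite actKV.
exact: le_outer.
Qed.

End invariance.

Hypothesis hausdorffT : hausdorff_space T.
Hypothesis compactT : compact [set: T].
Hypothesis uniqueT : pointwise_uniquely_ergodic R act.

(** Both contents induce invariant probabilities giving full mass to the orbit closure, so the two
    measures coincide; on open sets they are the inner contents. On a closed set the content itself
    may be smaller than the measure, hence the restriction to open sets. *)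
Lemma inner_content_unique (x : T) (lam lam' : set T -> \bar R) :
  closed_content lam -> closed_content lam' ->
  (forall g K, closed K -> lam (act g @^-1` K) = lam K) ->
  (forall g K, closed K -> lam' (act g @^-1` K) = lam' K) ->
  lam (closure (Defs.orbit act x)) = 1%E -> lam' (closure (Defs.orbit act x)) = 1%E ->
  forall U, open U -> inner_content lam U = inner_content lam' U.
Proof.
move=> lamC lamC' lam_inv lam_inv' lam1 lam1' U oU.
have [mu _ mu_unique] := uniqueT x.
have cO : closed (closure (Defs.orbit act x)) by exact: closed_closure.
have measurable_act g (A : set (borel x)) : measurable A ->
    measurable (act g @^-1` A : set (borel x)).
  move=> mA; rewrite -[X in measurable X]setTI.
  apply: (@measurability _ _ (borel x) (borel x) setT (act g) open) mA => //.
  move=> _ [V oV <-]; rewrite setTI; apply: sub_sigma_algebra.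
  by apply: open_comp oV => y _; exact: act_continuous.
have content_eq l : closed_content l ->
    (forall g K, closed K -> l (act g @^-1` K) = l K) ->
    l (closure (Defs.orbit act x)) = 1%E -> inner_content l U = mu U.
  move=> lC l_inv l1.
  have [nu nuE] := outer_content_measure lC hausdorffT compactT x.
  have mU : measurable (U : set (borel x)) by exact: sub_sigma_algebra.
  rewrite -outer_content_open// -nuE//; apply: mu_unique => //; split.
    by move=> g A mA; rewrite !nuE ?outer_content_invariant//; exact: measurable_act.
  by rewrite nuE ?(outer_content_full lC)//; exact: closed_borel.
by rewrite !content_eq.
Qed.

End invariant_content.

(** * Contents obtained from visit frequencies *)

Section folner_content.
Context {R : realType} {G : topologicalGroupType} {T : topologicalType}.
Variables (m : {measure set (borel (1%g : G)) -> \bar R}) (act : G -> T -> T).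
Hypothesis hausdorffG : hausdorff_space G.
Hypothesis haar_m : left_haar m.
Hypothesis actP : continuous_action act.
Implicit Types (F : nat -> set G) (W : set_system nat) (x : T) (A K : set T).

Definition visit_frequency F x A n : R := frequency m (F n) (act^~ x @^-1` A).

Definition visit_content F W x A : \bar R :=
  (lim (visit_frequency F x A n @[n --> W]))%:E.

Lemma orbit_preimage_closed x A : closed A -> closed (act^~ x @^-1` A).
Proof.
by move=> cA; apply: preimage_closed cA => t _; exact: orbit_map_continuous.
Qed.

Lemma orbit_preimage_borel x A : closed A ->
  measurable (act^~ x @^-1` A : set (borel (1%g : G))).
Proof. by move=> cA; apply: closed_borel; exact: orbit_preimage_closed. Qed.

Variable F : nat -> set G.
Hypothesis folnerF : folner m F.

Lemma visit_frequency01 x A : closed A -> forall n, 0 <= visit_frequency F x A n <= 1.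
Proof.
have [cF F_gt0 _] := folnerF; move=> cA n; apply: frequency01 => //.
exact: orbit_preimage_borel.
Qed.

Lemma upper_density_visit x A : closed A ->
  upper_density m F (act^~ x @^-1` A) = limn_esup (EFin \o visit_frequency F x A).
Proof.
have [cF F_gt0 _] := folnerF; move=> cA; congr limn_esup; apply/funext => n.
by rewrite (frequencyE hausdorffG haar_m)//; exact: orbit_preimage_borel.
Qed.

Variable W : set_system nat.
Hypothesis ultraW : UltraFilter W.
Hypothesis tailW : \oo `<=` W.

#[local] Instance proper_ultraW : ProperFilter W := ultra_proper.

Lemma visit_cvg x A : closed A -> visit_frequency F x A n @[n --> W] -->
  lim (visit_frequency F x A n @[n --> W]).
Proof. by move=> cA; apply: ultralimit_cvg; exact: visit_frequency01. Qed.

(** For each n the visit frequency is a finitely additive probability on closed sets, whose visit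
    times are Borel. All frequencies converge along [W], so the inequalities and sums pass to the
    limit. *)
Lemma visit_content_closed x : closed_content (visit_content F W x).
Proof.
have [cF F_gt0 _] := folnerF.
have pre_mble A : closed A ->
  measurable (act^~ x @^-1` A : set (borel (1%g : G))) by exact: orbit_preimage_borel.
split.
- rewrite /visit_content (_ : visit_frequency F x setT = cst 1) ?lim_cst//.
  by apply/funext => n; rewrite /visit_frequency preimage_setT frequencyT.
- move=> K cK; rewrite lee_fin; apply: limr_ge.
    by apply/cvg_ex; eexists; exact: visit_cvg.
  by apply: nearW => n; case/andP: (@visit_frequency01 x _ cK n).
- move=> K L cK cL KL; rewrite lee_fin; apply: ler_lim.
  + by apply/cvg_ex; eexists; exact: visit_cvg.
  + by apply/cvg_ex; eexists; exact: visit_cvg.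
  + apply: nearW => n; apply: le_frequency => //; [exact: pre_mble..|].
    exact: preimage_subset.
- move=> K L cK cL; rewrite -EFinD lee_fin.
  have KL := [elaborate cvgD (@visit_cvg x _ cK) (@visit_cvg x _ cL)].
  rewrite -(cvg_lim (@Rhausdorff R) KL); apply: ler_lim.
  + by apply/cvg_ex; eexists; apply: visit_cvg; exact: closedU.
  + by apply/cvg_ex; eexists; exact: KL.
  + apply: nearW => n; rewrite /visit_frequency preimage_setU.
    by apply: frequencyU => //; exact: pre_mble.
- move=> K L cK cL KL0; rewrite -EFinD lee_fin.
  have KL := [elaborate cvgD (@visit_cvg x _ cK) (@visit_cvg x _ cL)].
  rewrite -(cvg_lim (@Rhausdorff R) KL).
  suff -> : visit_frequency F x (K `|` L) =
    visit_frequency F x K \+ visit_frequency F x L by [].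
  apply/funext => n; rewrite /visit_frequency preimage_setU.
  apply: frequency_disjointU => //; [exact: pre_mble..|].
  by rewrite -preimage_setI KL0 preimage_set0.
Qed.

(** Visiting the preimage of [K] under [act g] at time t means visiting [K] at time g t. The error
    made by this translation vanishes by the Folner condition for the compact set {g}. *)
Lemma visit_content_invariant x g K : closed K ->
  visit_content F W x (act g @^-1` K) = visit_content F W x K.
Proof.
move=> cK; have [_ _ actM] := actP; have [cF F_gt0 F0] := folnerF.
have cgK : closed (act g @^-1` K).
  by apply: preimage_closed cK => y _; exact: act_continuous.
congr EFin; apply: (@eq_ultralimit _ W _ tailW _ _
  (fun n => fine (m (mulset [set g] (F n) `+` F n) / m (F n)))).
- exact: visit_frequency01.
- exact: visit_frequency01.
- move=> n; rewrite /visit_frequency.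
  have -> : act^~ x @^-1` (act g @^-1` K) =
      [set t | (act^~ x @^-1` K) (g * t)%g].
    by apply/seteqP; split => t /=; rewrite actM.
  by apply: frequency_translate => //; exact: orbit_preimage_closed.
- by apply: (fine_cvg (F0 _ (@compact_set1 _ g) _)); exists g.
Qed.

Lemma visit_content_orbit x : visit_content F W x (closure (Defs.orbit act x)) = 1%E.
Proof.
have [<- _ _ _ _] := visit_content_closed x.
congr (lim (_ @[n --> W]))%:E; apply/funext => n; congr frequency.
by apply/seteqP; split => // t _; apply: subset_closure; exists t.
Qed.

End folner_content.

(** * Comparison of upper densities along two Folner sequences *)

Section folner_independence.
Context {R : realType} {G : topologicalGroupType} {T : topologicalType}.
Variables (m : {measure set (borel (1%g : G)) -> \bar R}) (act : G -> T -> T).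
Hypothesis hausdorffG : hausdorff_space G.
Hypothesis haar_m : left_haar m.
Hypothesis actP : continuous_action act.
Hypothesis hausdorffT : hausdorff_space T.
Hypothesis compactT : compact [set: T].
Hypothesis uniqueT : pointwise_uniquely_ergodic R act.

(** The open set [U] between [K] and [C] is where unique ergodicity applies: up to [e], the density
    of [K] along [F] is at most the content of [K], then the inner content of [U], which is the same
    for [F'], then the content of [C] for [F'], and so its density along [F']. *)
Lemma upper_density_folner (F F' : nat -> set G) (x : T) (K U C : set T) :
  folner m F -> folner m F' -> closed K -> open U -> closed C ->
  K `<=` U -> U `<=` C ->
  (upper_density m F (act^~ x @^-1` K) <= upper_density m F' (act^~ x @^-1` C))%E.
Proof.
move=> folF folF' cK oU cC KU UC; apply/lee_addgt0Pr => e e0.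
have freqF := visit_frequency01 hausdorffG haar_m actP folF x.
have freqF' := visit_frequency01 hausdorffG haar_m actP folF' x.
rewrite !(upper_density_visit hausdorffG haar_m actP)//.
(* [W] is chosen to nearly attain the upper density along [F]. The same [W] serves [F'], where any
   ultrafilter containing the tails bounds the upper density from below. *)
have [W [ultraW tailW LW]] := limn_esup_le_ultralimit (freqF _ cK) e0.
apply: le_trans LW _; apply: leeD2r.
apply: le_trans (ultralimit_le_limn_esup _ (freqF' _ cC)); last exact: tailW.
rewrite -!/(visit_content _ _ _ _ _ _).
apply: (@le_trans _ _ (inner_content (visit_content m act F W x) U)).
  exact: inner_content_ub.
rewrite (@inner_content_unique _ _ _ _ actP hausdorffT compactT uniqueT x _
  (visit_content m act F' W x)) //.
- apply: ge_ereal_sup => _ [L [cL LU] <-].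
  have [_ _ le_content _ _] :=
    visit_content_closed hausdorffG haar_m actP folF' ultraW x.
  by apply: le_content => //; exact: subset_trans UC.
- exact: visit_content_closed.
- exact: visit_content_closed.
- by move=> g A cA; exact: visit_content_invariant.
- by move=> g A cA; exact: visit_content_invariant.
- exact: visit_content_orbit.
- exact: visit_content_orbit.
Qed.

End folner_independence.

(** * Existence of Folner sequences *)

Section folner_existence.
Context {R : realType} {G : topologicalGroupType}.
Variable m : {measure set (borel (1%g : G)) -> \bar R}.
Hypothesis hausdorffG : hausdorff_space G.
Hypothesis haar_m : left_haar m.
Local Notation measurableG A := (measurable (A : set (borel (1%g : G)))).

(* For [k] in [K], the sets [F `\` (k F)] and [(k F) `\` F] have the same
   measure since [k F] and [F] do. *)
Lemma haar_mulset_symdiff (K F : set G) : compact K -> K !=set0 -> compact F ->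
  (m (mulset K F `+` F) <= m (mulset K F `\` F) + m (mulset K F `\` F))%E.
Proof.
move=> cK [k Kk] cF; have [_ mfin minv _ _] := haar_m.
have mF : measurableG F by exact: compact_borel.
have ckF : compact (mulset [set k] F).
  by apply: mulset_compact => //; exact: compact_set1.
have mkF : measurableG (mulset [set k] F) by exact: compact_borel.
have mKF : measurableG (mulset K F).
  by apply: compact_borel => //; exact: mulset_compact.
have mF_kF : (m F <= m (mulset [set k] F))%E by rewrite mulset1g minv.
have kK : mulset [set k] F `<=` mulset K F.
  by move=> _ [_ -> [a Fa <-]]; exists k => //; exists a.
apply: le_trans (measureU2 _ (measurableD mKF mF) (measurableD mF mKF)) _.
apply: leeD2l; apply: (@le_trans _ _ (m (F `\` mulset [set k] F))).
  apply: le_measure; rewrite ?inE; [exact: measurableD..|].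
  by apply: setDS.
apply: (@le_trans _ _ (m (mulset [set k] F `\` F))); last first.
  apply: le_measure; rewrite ?inE; [exact: measurableD..|].
  by apply: setSD.
rewrite (measureD mF mkF (mfin _ cF)) (measureD mkF mF (mfin _ ckF)) setIC.
exact: leeD2r mF_kF.
Qed.

Hypothesis locally_compactG : locally_compact [set: G].
Hypothesis sigma_compactG : sigma_compact [set: G].

(** Compact sets that merely cover the group need not absorb every compact set. Thickening their
    finite unions by a compact neighbourhood [W] of 1 makes each point [x] have a whole
    neighbourhood, x[W], in all sets of large index. The point 1 is added to keep every set
    nonempty. *)
Lemma compact_exhaustion : exists K : nat -> set G,
  [/\ forall n, compact (K n), forall n, K n !=set0 &
      forall L, compact L -> \forall n \near \oo, L `<=` K n].
Proof.
have [C cC GC] := sigma_compactG.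
have [W Wn [cW _]] := locally_compactG (I : [set: G] 1%g).
have W1 : nbhs (1%g : G) W by move: Wn; rewrite /within/=; apply: filterS => t; exact.
exists (fun n => [set 1%g] `|` mulset (\big[setU/set0]_(i < n) C i) W); split.
- move=> n; apply: compactU; first exact: compact_set1.
  by apply: mulset_compact => //; exact: bigsetU_compact.
- by move=> n; exists 1%g; left.
- move=> L /compact_near_coveringP cL.
  apply: (cL nat \oo (fun n => [set 1%g] `|` mulset (\big[setU/set0]_(i < n) C i) W)).
  move=> x _; have [k _ Ckx] : (\bigcup_n C n) x by rewrite -GC.
  have Wx : \forall y \near x, W (x^-1 * y)%g.
    by apply: (mulg_continuousl (g := x^-1%g)); rewrite mulVg.
  exists ([set y | W (x^-1 * y)%g], [set n | (k < n)%N]) => /=.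
    by split => //; exists k.+1.
  move=> [y n] /= [Wy kn]; right; exists x; first by rewrite -bigcup_mkord; exists k.
  by exists (x^-1 * y)%g => //; rewrite mulgA mulgV mul1g.
Qed.

Lemma folner_exists : amenable m -> exists F : nat -> set G, folner m F.
Proof.
move=> amenableG; have [K [cK K0 Kexh]] := compact_exhaustion.
(* The factor 1/2 compensates the doubling in [haar_mulset_symdiff], leaving the bound 1/(n+1). *)
pose e n : R := n.+1%:R^-1 / 2.
have e0 n : 0 < e n by rewrite divr_gt0// invr_gt0 ltr0n.
have [F /all_and2[cF KF]] : {F : nat -> set G & forall n, compact (F n) /\
    (m (mulset (K n) (F n) `+` F n) < (e n)%:E * m (F n))%E}.
  apply: (@choice _ _ (fun n A => compact A /\
    (m (mulset (K n) A `+` A) < (e n)%:E * m A)%E)) => n.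
  by have [A] := amenableG _ _ (cK n) (K0 n) (e0 n); exists A.
(* Positivity comes from the strict inequality in amenability, whose left-hand side is
   nonnegative. *)
have F_gt0 n : (0 < m (F n))%E.
  rewrite -(@pmule_rgt0 _ (e n)%:E) ?lte_fin//.
  exact: le_lt_trans (measure_ge0 _ _) (KF n).
exists F; split => // L cL L0.
apply: (@squeeze_cvge _ _ _ _ (cst 0%E) _ (EFin \o harmonic)).
- apply: filterS (Kexh L cL) => n LKn /=.
  rewrite mule_ge0 ?measure_ge0 ?inve_ge0//=.
  have Ffin : m (F n) \is a fin_num by exact: haar_compact_fin.
  have F0 : 0 < fine (m (F n)) by rewrite fine_gt0// F_gt0 ltey_eq Ffin.
  rewrite -[X in (_ / X)%E](fineK Ffin) inver gt_eqF// lee_pdivrMr// fineK//.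
  (* The symmetric difference is not monotone in the acting set, whereas [mulset L (F n)] minus
     [F n] is; so the estimate for [K n] passes to its subset [L] through this difference. *)
  apply: le_trans (haar_mulset_symdiff cL L0 (cF n)) _.
  have mble A : compact A -> measurableG A by exact: compact_borel.
  have LF : (m (mulset L (F n) `\` F n) <= (e n)%:E * m (F n))%E.
    apply: ltW; apply: le_lt_trans (KF n).
    have mKF : measurableG (mulset (K n) (F n)).
      by apply: mble; exact: mulset_compact.
    apply: le_measure; rewrite ?inE.
    + by apply: measurableD; apply: mble; rewrite ?cF//; exact: mulset_compact.
    + by apply: measurableU; apply: measurableD => //; apply: mble; exact: cF.
    + by move=> _ [[a La [b Fb <-]] nF]; left; split => //;
        exists a; [exact: LKn|exists b].
  apply: le_trans (leeD LF LF) _.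
  have en0 : (0 <= (e n)%:E)%E by rewrite lee_fin ltW.
  by rewrite -ge0_muleDl// -EFinD /e -splitr.
- exact: cvg_cst.
- exact: cvge_harmonic.
Qed.

End folner_existence.

(** * Separation numbers *)

Lemma hausdorff_setX (S T : topologicalType) :
  hausdorff_space S -> hausdorff_space T -> hausdorff_space (S * T)%type.
Proof.
move=> hS hT [p1 p2] [q1 q2] pq; congr pair.
- apply: hS => A B Ap Bq.
  have [||z [Az Bz]] := pq (fst @^-1` A) (fst @^-1` B).
  + exact: (@cvg_fst _ _ (nbhs p1) (nbhs p2)).
  + exact: (@cvg_fst _ _ (nbhs q1) (nbhs q2)).
  + by exists z.1.
- apply: hT => A B Ap Bq.
  have [||z [Az Bz]] := pq (snd @^-1` A) (snd @^-1` B).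
  + exact: (@cvg_snd _ _ (nbhs p1) (nbhs p2)).
  + exact: (@cvg_snd _ _ (nbhs q1) (nbhs q2)).
  + by exists z.2.
Qed.

Lemma mdist_continuous (R : realType) (X : metricType R) :
  continuous (fun p : X * X => mdist p.1 p.2).
Proof.
move=> [x y]; apply/cvgrPdist_lt => e e0 /=.
have e20 : 0 < e / 2 by rewrite divr_gt0.
exists (ball x (e / 2), ball y (e / 2)); first by split; exact: nbhsx_ballx.
move=> [a b] [/=]; rewrite !ballEmdist /= => xa yb.
have xy_le : mdist x y <= mdist x a + mdist a b + mdist y b.
  rewrite (metric_sym y) -addrA; apply: le_trans (metric_triangle x a y) _.
  by rewrite lerD2l metric_triangle.
have ab_le : mdist a b <= mdist x a + mdist x y + mdist y b.
  rewrite (metric_sym x a) -addrA; apply: le_trans (metric_triangle a x b) _.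
  by rewrite lerD2l metric_triangle.
by rewrite ltr_norml; apply/andP; split; lra.
Qed.

Section limf_monotone.
Context {R : realType} {T : choiceType} {X : filteredType T}.
Variables (F : set_system X) (filterF : Filter F).
Implicit Types f g : X -> \bar R.

Lemma le_limf_esup f g :
  (\forall x \near F, (f x <= g x)%E) -> (limf_esup f F <= limf_esup g F)%E.
Proof.
move=> fg; apply: le_ereal_inf_tmp => _ [V FV <-].
apply: (@le_trans _ _ (ereal_sup (f @` (V `&` [set x | (f x <= g x)%E])))).
  by apply: ereal_inf_lbound; exists (V `&` [set x | (f x <= g x)%E]) => //;
    exact: filterI.
apply: ge_ereal_sup => _ [x [Vx fgx] <-]; apply: le_trans fgx _.
by apply: ereal_sup_ubound; exists x.
Qed.

Lemma le_limf_einf f g :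
  (\forall x \near F, (f x <= g x)%E) -> (limf_einf f F <= limf_einf g F)%E.
Proof.
move=> fg; rewrite leeN2; apply: le_limf_esup.
by apply: filterS fg => x; rewrite leeN2.
Qed.

End limf_monotone.

Section separation_numbers.
Context {R : realType} {G : topologicalGroupType} {X : metricType R}.
Variables (m : {measure set (borel (1%g : G)) -> \bar R}) (act : G -> X -> X).
Hypothesis hausdorffG : hausdorff_space G.
Hypothesis haar_m : left_haar m.
Hypothesis compactX : compact [set: X].
Hypothesis actP : continuous_action act.
Hypothesis uniqueX2 : pointwise_uniquely_ergodic R (product_action act).

Lemma product_action_continuous : continuous_action (product_action act).
Proof.
have [cact act1 actM] := actP; split.
- have act_comp (f : X * X -> X) : continuous f ->
      continuous (fun p : G * (X * X) => act p.1 (f p.2)).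
    move=> cf p; apply: (@continuous_comp _ _ _
      (fun p : G * (X * X) => (p.1, f p.2)) (fun p : G * X => act p.1 p.2)).
      apply: cvg_pair => /=; first exact: cvg_fst.
      by apply: (@continuous_comp _ _ _ snd f); [exact: cvg_snd|exact: cf].
    exact: cact.
  move=> p; apply: cvg_pair => /=.
  + by apply: (act_comp fst) => q; exact: cvg_fst.
  + by apply: (act_comp snd) => q; exact: cvg_snd.
- by move=> [x y]; rewrite /product_action !act1.
- by move=> g h [x y]; rewrite /product_action !actM.
Qed.

Variables F F' : nat -> set G.
Hypothesis folnerF : folner m F.
Hypothesis folnerF' : folner m F'.

(** Separation times are the visit times of the pair ([x], [y]) to a closed superlevel set of the
    distance; a strict superlevel set supplies the open set in between. *)
Lemma upper_density_separation (delta' delta : R) (x y : X) : delta' < delta ->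
  (upper_density m F (separation_times act delta x y)
   <= upper_density m F' (separation_times act delta' x y))%E.
Proof.
move=> dd; apply: (upper_density_folner hausdorffG haar_m
  product_action_continuous _ _ uniqueX2 (x, y)
  (K := [set p | delta <= mdist p.1 p.2]) (U := [set p | delta' < mdist p.1 p.2])
  (C := [set p | delta' <= mdist p.1 p.2]) folnerF folnerF').
- by apply: hausdorff_setX; exact: metric_hausdorff.
- by rewrite -setXTT; exact: compact_setX.
- apply: (@preimage_closed _ _ _ [set r | delta <= r]); last exact: closed_ge.
  by move=> p _; exact: mdist_continuous.
- apply: (@open_comp _ _ _ [set r | delta' < r]); last exact: open_gt.
  by move=> p _; exact: mdist_continuous.
- apply: (@preimage_closed _ _ _ [set r | delta' <= r]); last exact: closed_ge.
  by move=> p _; exact: mdist_continuous.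
- by move=> p; exact: lt_le_trans.
- by move=> p; exact: ltW.
Qed.

(** Changing the Folner sequence costs only a smaller [delta]. Since [nu] is kept, the complexity
    quotients can be compared at each small [nu]. *)
Lemma le_Sep (delta' delta nu : R) : delta' < delta ->
  (Sep m act F delta nu <= Sep m act F' delta' nu)%E.
Proof.
move=> dd; apply: ge_ereal_sup => _ [S sepS <-]; apply: ereal_sup_ubound.
exists S => // x y Sx Sy xy; apply: le_trans (sepS x y Sx Sy xy) _.
exact: upper_density_separation.
Qed.

Lemma Sep_ge0 (E : nat -> set G) (delta nu : R) : (0 <= Sep m act E delta nu)%E.
Proof.
apply: (@le_trans _ _ (counting (set0 : set X))).
  by rewrite /counting; case: ifP => _; rewrite ?leey ?lee_fin.
by apply: ereal_sup_ubound; exists set0.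
Qed.

Lemma finite_separation_numbers_folner :
  finite_separation_numbers m act F' -> finite_separation_numbers m act F.
Proof.
move=> finF' delta nu delta0 nu01; have d20 : 0 < delta / 2 by rewrite divr_gt0.
apply: le_lt_trans (finF' (delta / 2) nu d20 nu01).
by apply: le_Sep; rewrite gtr_pMr// invf_lt1 ?ltr1n.
Qed.

Lemma le_ac_quotient (delta' delta : R) : delta' < delta ->
  \forall nu \near 0^'+,
    (ac_quotient m act F delta nu <= ac_quotient m act F' delta' nu)%E.
Proof.
move=> dd; near=> nu; have nu0 : 0 < nu by [].
have lnu : 0 < - ln nu.
  (* Here [nu] < 1 near 0, which makes the denominator positive. *)
  by rewrite oppr_gt0 ln_lt0// nu0/=; near: nu; exact: nbhs_right_lt.
apply: lee_wpmul2r; first by rewrite inve_ge0 lee_fin ltW.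
by rewrite lee_lne ?in_itv/= ?leey ?Sep_ge0// le_Sep.
Unshelve. all: by end_near. Qed.

(** [L] stands for the lower or the upper limit at 0, so both complexities are treated at once.
    Halving [delta] is harmless under the supremum. *)
Lemma le_ac_sup (L : (R -> \bar R) -> \bar R) :
  (forall f g : R -> \bar R,
     (\forall nu \near 0^'+, (f nu <= g nu)%E) -> (L f <= L g)%E) ->
  (ereal_sup [set L (ac_quotient m act F delta) |
                delta in [set delta | (0 < delta)%R]]
   <= ereal_sup [set L (ac_quotient m act F' delta) |
                   delta in [set delta | (0 < delta)%R]])%E.
Proof.
move=> leL; apply: ge_ereal_sup => _ [delta /= delta0 <-].
apply: (@le_trans _ _ (L (ac_quotient m act F' (delta / 2)))).
  by apply/leL/le_ac_quotient; rewrite gtr_pMr// invf_lt1 ?ltr1n.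
by apply: ereal_sup_ubound; exists (delta / 2) => //=; rewrite divr_gt0.
Qed.

End separation_numbers.

Theorem theorem1p2 (R : realType) (G : topologicalGroupType)
    (m : {measure set (borel (1%g : G)) -> \bar R})
    (X : metricType R) (act : G -> X -> X)
    (hausdorffG : hausdorff_space G)
    (locally_compactG : locally_compact [set: G])
    (sigma_compactG : sigma_compact [set: G])
    (haar_m : left_haar m)
    (amenableG : amenable m)
    (compactX : compact [set: X])
    (act_continuous : continuous_action act)
    (act2_uniquely_ergodic :
       pointwise_uniquely_ergodic R (product_action act)) :
  ((exists2 F : nat -> set G,
      folner m F & infinite_separation_numbers m act F)
   <->
   (forall F : nat -> set G,
      folner m F -> infinite_separation_numbers m act F))
  /\
  (forall F F' : nat -> set G, folner m F -> folner m F' ->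
     upper_ac m act F = upper_ac m act F' /\
     lower_ac m act F = lower_ac m act F').
Proof.
have fin_folner F F' : folner m F -> folner m F' ->
    finite_separation_numbers m act F' -> finite_separation_numbers m act F.
  exact: finite_separation_numbers_folner.
split.
  split=> [[F folF infF] F' folF' /(fin_folner _ _ folF folF')//|inf].
  have [F folF] := folner_exists hausdorffG haar_m locally_compactG
    sigma_compactG amenableG.
  by exists F => //; exact: inf.
(* The roles of [F] and [F'] are symmetric, so inequalities suffice. *)
suff le_ac F F' : folner m F -> folner m F' ->
    (upper_ac m act F <= upper_ac m act F')%E /\
    (lower_ac m act F <= lower_ac m act F')%E.
  move=> F F' folF folF'.
  have [uFF' lFF'] := le_ac _ _ folF folF'.
  have [uF'F lF'F] := le_ac _ _ folF' folF.
  split; apply/le_anti/andP.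
  - exact: conj uFF' uF'F.
  - exact: conj lFF' lF'F.
move=> folF folF'; rewrite /upper_ac /lower_ac.
case: asboolP => [infF|_]; case: asboolP => [infF'|finF'].
- by rewrite !leey.
- by case: finF' => finF'; exact/infF/(fin_folner _ _ folF folF').
- by rewrite !leey.
- have ac_sup := le_ac_sup hausdorffG haar_m compactX act_continuous
    act2_uniquely_ergodic folF folF'.
  split.
  + by apply: (ac_sup (fun f => limf_esup f 0^'+)) => f g; exact: le_limf_esup.
  + by apply: (ac_sup (fun f => limf_einf f 0^'+)) => f g; exact: le_limf_einf.
Qed.
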